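(* Let $B>1$ and $N>1$ be integers with $\gcd(N,B)=1$, let $e=\operatorname{ord}(B,N)$, and let $e=dk$ with $d,k$ positive integers. Let $N^*=\{x\in\mathbb{Z}: 1\le x<N,\ \gcd(x,N)=1\}$. For $x\in N^*$ define $x_1=x$, $a_i=\lfloor Bx_i/N\rfloor$, $x_{i+1}=Bx_i-a_iN$ ($i\ge1$), $A_j=\sum_{i=1}^{k} a_{(j-1)k+i}B^{k-i}$ for $1\le j\le d$, $R_d(x)=\sum_{j=1}^d x_{(j-1)k+1}$ and $S_d(x)=\sum_{j=1}^d A_j$. Say that $N\in M_d(B)$ if $S_d(x)\equiv 0\pmod{B^k-1}$ for every $x\in N^*$. Then the following are equivalent: (i) $N\in M_d(B)$; (ii) for some $x\in N^*$, $S_d(x)\equiv 0\pmod{B^k-1}$; (iii) for some $x\in N^*$, $R_d(x)\equiv 0 \pmod N$; (iv) $B^{k(d-1)}+B^{k(d-2)}+\dots+B^k+1\equiv 0\pmod N$. Furthermore, if $\gcd(B^k-1,N)=1$ then $N\in M_d(B)$.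
   Context: $\operatorname{ord}(B,N)$ is the least positive integer $e$ with $B^e\equiv1\pmod N$. The $a_i$ are the base-$B$ digits of $x/N=0.a_1a_2\ldots$ (period $a_1\ldots a_e$), the $x_i$ are the successive remainders of long division, and $A_j$ is the integer represented in base $B$ by the $j$-th block of $k$ consecutive digits of the period. *)

(* Defs.v *)
(* All the integers involved are nonnegative, so everything is stated in nat. *)
From mathcomp Require Import all_boot.

Set Implicit Arguments.
Unset Strict Implicit.
Unset Printing Implicit Defensive.

Definition is_ord (B N e : nat) : Prop :=
  [/\ 0 < e, B ^ e = 1 %[mod N]
    & forall f, 0 < f -> B ^ f = 1 %[mod N] -> e <= f].

Definition Nstar (N : nat) : pred nat := [pred x | (1 <= x < N) && coprime x N].

Section LongDivision.

Variables B N x : nat.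

(* The truncated subtraction is exact, since (B * r %/ N) * N <= B * r. *)
Definition next_rem (r : nat) : nat := B * r - (B * r %/ N) * N.

(* The indices of [remainder], [digit] and [block] start at 1, as in x_1, a_1, A_1;
   the values at index 0 are never used. *)
Definition remainder (i : nat) : nat := iter i.-1 next_rem x.

Definition digit (i : nat) : nat := B * remainder i %/ N.

Definition block (k j : nat) : nat :=
  \sum_(1 <= i < k.+1) digit ((j - 1) * k + i) * B ^ (k - i).

Definition remainder_sum (d k : nat) : nat :=
  \sum_(1 <= j < d.+1) remainder ((j - 1) * k + 1).

Definition block_sum (d k : nat) : nat := \sum_(1 <= j < d.+1) block k j.

End LongDivision.

(* N \in M_d(B); the block length k is ord(B, N) / d, and is passed explicitly
   rather than recomputed from d. *)
Definition inM (B d k N : nat) : Prop :=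
  forall x, x \in Nstar N -> block_sum B N x d k = 0 %[mod B ^ k - 1].

(* Main.v *)
Require Import Defs.
From mathcomp Require Import all_boot.

(* Unrolling k steps of the long division gives
   B^k x_(m+1) = N A + x_(m+k+1), where A is the integer whose base-B digits are
   a_(m+1), ..., a_(m+k).  As B^(dk) = 1 mod N, the remainders have period dk, so
   summing over the d blocks telescopes to (B^k - 1) R_d(x) = N S_d(x); hence
   B^k - 1 divides S_d(x) iff N divides R_d(x).  On the other hand
   R_d(x) = x (1 + B^k + ... + B^(k(d-1))) mod N with x invertible mod N, so this
   condition does not depend on x.  Finally B^k - 1 times the geometric sum is
   B^(dk) - 1 = 0 mod N. *)

Lemma next_remE (B N r : nat) : next_rem B N r = B * r %% N.
Proof. by rewrite /next_rem {1}(divn_eq (B * r) N) addKn. Qed.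

Lemma remainderS (B N x n : nat) :
  remainder B N x n.+2 = B * remainder B N x n.+1 %% N.
Proof. exact: next_remE. Qed.

Lemma remainderE (B N x n : nat) : x < N ->
  remainder B N x n.+1 = B ^ n * x %% N.
Proof.
move=> ltxN; elim: n => [|n IHn]; first by rewrite expn0 mul1n modn_small.
by rewrite remainderS IHn modnMmr mulnA -expnS.
Qed.

(** Induction on [k], one division step at a time; the free offset [m] lets the identity start at
    any block. *)
Lemma digits_remainder (B N x m k : nat) :
  N * (\sum_(1 <= i < k.+1) digit B N x (m + i) * B ^ (k - i))
    + remainder B N x (m + k).+1 = B ^ k * remainder B N x m.+1.
Proof.
elim: k => [|k IHk]; first by rewrite big_nil muln0 addn0 expn0 mul1n.
rewrite big_nat_recr //= subnn expn0 muln1.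
(* Horner's rule: appending a digit shifts the earlier ones up one place. *)
have -> : \sum_(1 <= i < k.+1) digit B N x (m + i) * B ^ (k.+1 - i)
    = B * \sum_(1 <= i < k.+1) digit B N x (m + i) * B ^ (k - i).
  rewrite big_distrr /=; apply: eq_big_nat => i /andP[_ ltik].
  by rewrite subSn // expnS mulnCA.
have step : N * digit B N x (m + k.+1) + remainder B N x (m + k.+1).+1
    = B * remainder B N x (m + k).+1.
  by rewrite addnS remainderS mulnC -divn_eq.
by rewrite mulnDr -addnA step mulnCA -mulnDr IHk mulnA -expnS.
Qed.

Lemma block_remainder (B N x k j : nat) :
  N * block B N x k j.+1 + remainder B N x (j.+1 * k).+1
    = B ^ k * remainder B N x (j * k).+1.
Proof. by rewrite /block subn1 mulSnr digits_remainder. Qed.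

Lemma remainder_sumE (B N x d k : nat) :
  remainder_sum B N x d k = \sum_(0 <= j < d) remainder B N x (j * k).+1.
Proof.
by rewrite /remainder_sum big_add1; apply: eq_bigr => j _; rewrite subn1 addn1.
Qed.

Lemma block_sum_remainder_sum (B N x d k : nat) :
  x < N -> B ^ (d * k) = 1 %[mod N] ->
  N * block_sum B N x d k = (B ^ k - 1) * remainder_sum B N x d k.
Proof.
move=> ltxN Bdk1.
have periodic : remainder B N x (d * k).+1 = remainder B N x 1.
  by rewrite !remainderE // -modnMml Bdk1 modnMml.
have shifted : \sum_(0 <= j < d) remainder B N x (j.+1 * k).+1
    = \sum_(0 <= j < d) remainder B N x (j * k).+1.
  (* Adding the first remainder completes both sums to [d.+1] terms: on the right it is the term
     [j = 0], on the left, by periodicity, the term [j = d]. *)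
  apply: (@addnI (remainder B N x 1)).
  rewrite -[X in X + _ = _]/(remainder B N x (0 * k).+1).
  rewrite -(big_nat_recl d 0 (fun j => remainder B N x (j * k).+1)) //.
  by rewrite big_nat_recr //= periodic addnC.
(* Only the subtracted sum is shifted, so that each difference of terms is [N] times a block. *)
rewrite mulnBl mul1n /block_sum big_add1 remainder_sumE /= -{2}shifted.
rewrite !big_distrr /= -(eq_bigr _ (fun j _ => block_remainder B N x k j)).
by rewrite big_split /= addnK.
Qed.

Lemma remainder_sum_mod (B N x d k : nat) : x < N ->
  remainder_sum B N x d k = x * \sum_(0 <= j < d) B ^ (k * j) %[mod N].
Proof.
move=> ltxN; rewrite remainder_sumE big_distrr /= -[in RHS]modn_summ.
rewrite -modn_summ; congr (_ %% _); apply: eq_bigr => j _.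
by rewrite remainderE // modn_mod mulnC [j * k]mulnC.
Qed.

Lemma dvdn_remainder_sum (B N x d k : nat) : x \in Nstar N ->
  (N %| remainder_sum B N x d k) = (N %| \sum_(0 <= j < d) B ^ (k * j)).
Proof.
rewrite inE => /andP[/andP[_ ltxN] coxN].
by rewrite /dvdn remainder_sum_mod // -/(dvdn _ _) Gauss_dvdr // coprime_sym.
Qed.

Lemma dvdn_block_sum (B N x d k : nat) :
  1 < B -> 0 < k -> B ^ (d * k) = 1 %[mod N] -> x \in Nstar N ->
  (B ^ k - 1 %| block_sum B N x d k) = (N %| \sum_(0 <= j < d) B ^ (k * j)).
Proof.
move=> B1 k0 Bdk1 xN; rewrite -(dvdn_remainder_sum _ _ _ _ _ xN).
move: xN; rewrite inE => /andP[/andP[x0 ltxN] _].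
have N0 : 0 < N by apply: leq_ltn_trans ltxN.
have Bk0 : 0 < B ^ k - 1 by rewrite subn_gt0 -(exp1n k) ltn_exp2r.
(* After scaling by [N], both sides of the divisibility contain the positive factor [B ^ k - 1],
   which cancels. *)
rewrite -(dvdn_pmul2l N0) block_sum_remainder_sum //.
by rewrite mulnC dvdn_pmul2l.
Qed.

Theorem theorem2 (B N e d k : nat) (hB : 1 < B) (hN : 1 < N)
    (hNB : coprime N B) (he : is_ord B N e)
    (hd : 0 < d) (hk : 0 < k) (hedk : e = d * k) :
  [<-> inM B d k N;
       exists2 x, x \in Nstar N & block_sum B N x d k = 0 %[mod B ^ k - 1];
       exists2 x, x \in Nstar N & remainder_sum B N x d k = 0 %[mod N];
       \sum_(0 <= j < d) B ^ (k * j) = 0 %[mod N]]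
  /\ (coprime (B ^ k - 1) N -> inM B d k N).
Proof.
have Bdk1 : B ^ (d * k) = 1 %[mod N] by case: he; rewrite hedk.
have mod0P m n : m = 0 %[mod n] <-> n %| m.
  by rewrite mod0n; split=> /eqP.
(* Serves both to close the cycle of implications and to prove the final claim. *)
have inMP : N %| \sum_(0 <= j < d) B ^ (k * j) -> inM B d k N.
  by move=> dvdN x xN; apply/mod0P; rewrite dvdn_block_sum.
split.
  tfae.
  - have N1 : 1 \in Nstar N by rewrite inE /= hN coprime1n.
    by move=> inMN; exists 1 => //; apply: inMN.
  - case=> x xN /mod0P; rewrite dvdn_block_sum // => dvdN.
    by exists x => //; apply/mod0P; rewrite dvdn_remainder_sum.
  - by case=> x xN /mod0P; rewrite dvdn_remainder_sum // => /mod0P.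
  - by move/mod0P/inMP.
move=> coBN; apply: inMP.
(* By coprimality, the geometric sum may be multiplied by [B ^ k - 1], which makes it telescope. *)
rewrite -(Gauss_dvdr _ (n := B ^ k - 1)) 1?coprime_sym //.
have -> : (B ^ k - 1) * \sum_(0 <= j < d) B ^ (k * j) = B ^ (d * k) - 1.
  rewrite [d * k]mulnC expnM !subn1 (predn_exp (B ^ k)) big_mkord.
  by congr (_ * _); apply: eq_bigr => i _; rewrite expnM.
by rewrite -eqn_mod_dvd ?expn_gt0 ?(ltnW hB) //; apply/eqP.
Qed.
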